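(* Let $0<q<1$, and let $\{p_n(z;q)\}_{n}$ and $\{\hat p_n(z;q)\}_{n}$ be conjugate odd $q$-Lidstone-type I sequences, where $\{p_n(z;q)\}_n$ is related to the numerical sequence $(\alpha_{2n})_{n\ge0}$. Then $$g_q(t)\,\frac{\sinh_q(zt)}{t}=\sum_{n=0}^\infty p_n(z;q)\,\frac{t^{2n}}{[2n+1]_q!},\qquad \frac{1}{g_q(t)}\,\frac{\sinh_q(zt)}{t}=\sum_{n=0}^\infty \hat p_n(z;q)\,\frac{t^{2n}}{[2n+1]_q!},$$ where $g_q(t)$ is the function defined by the power series $g_q(t)=\sum_{n=0}^\infty \alpha_{2n}\frac{t^{2n}}{[2n+1]_q!}$.
   Context: Fix $0<q<1$. Put $[m]_q=\frac{1-q^m}{1-q}$, $[m]_q!=\prod_{j=1}^m[j]_q$, $[0]_q!=1$, and ${n \brack k}_q=\frac{[n]_q!}{[k]_q!\,[n-k]_q!}$ for $0\le k\le n$. $\mathbb N=\{1,2,\dots\}$, $\mathbb N_0=\mathbb N\cup\{0\}$. The Jackson $q$-derivative is $D_qf(z)=\frac{f(qz)-f(z)}{(q-1)z}$ for $z\ne0$ and $D_qf(0)=f'(0)$, so $D_qz^m=[m]_qz^{m-1}$. An odd $q$-Lidstone polynomial sequence of type I is a sequence $\{p_n(z;q)\}_{n\in\mathbb N_0}$ of polynomials in $z$ with real coefficients such that $D_q^2p_n(z;q)=[2n+1]_q[2n]_q\,p_{n-1}(z;q)$ for $n\in\mathbb N$, $p_n(0;q)=0$ for $n\in\mathbb N_0$,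 and $p_0(z;q)=\alpha_0z$ with $\alpha_0\in\mathbb R\setminus\{0\}$. The numerical sequence related to it is $\alpha_{2n}:=D_qp_n(0;q)$, and $p_n(z;q)=\sum_{k=0}^n {2n+1 \brack 2k+1}_q\frac{\alpha_{2(n-k)}}{[2(n-k)+1]_q}z^{2k+1}$. The sequence $(\beta_{2n})_{n\ge0}$ is the numerical sequence satisfying $\sum_{j=0}^n \frac{\beta_{2j}\,\alpha_{2(n-j)}}{[2j+1]_q!\,[2(n-j)+1]_q!}=\delta_{n0}$ for all $n\in\mathbb N_0$ ($\delta$ is Kronecker's delta). With $\hat p_n(z;q)=\sum_{k=0}^n {2n+1 \brack 2k+1}_q\frac{\beta_{2(n-k)}}{[2(n-k)+1]_q}z^{2k+1}$, the two sequences $\{p_n\}_n$ and $\{\hat p_n\}_n$ are called conjugate odd $q$-Lidstone-type (I) sequences. $\sinh_q(x)=\sum_{n=0}^\infty\frac{x^{2n+1}}{[2n+1]_q!}$. Since $\alpha_0\neq0$, $1/g_q(t)$ is well defined, with series representation $\frac1{g_q(t)}=\sum_{n=0}^\infty\beta_{2n}\frac{t^{2n}}{[2n+1]_q!}$. *)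

(* Defs.v *)
From mathcomp Require Import all_boot all_order all_algebra.
From mathcomp Require Import complex.
From mathcomp Require Import all_classical all_reals all_analysis.
Set Implicit Arguments.
Unset Strict Implicit.
Unset Printing Implicit Defensive.
Import Order.TTheory GRing.Theory Num.Theory.
Import numFieldNormedType.Exports.
Local Open Scope classical_set_scope.
Local Open Scope ring_scope.

Definition qnum (R : realType) (q : R) (m : nat) : R := (1 - q ^+ m) / (1 - q).

Definition qfact (R : realType) (q : R) (m : nat) : R :=
  \prod_(1 <= j < m.+1) qnum q j.

Definition qbinom (R : realType) (q : R) (n k : nat) : R :=
  qfact q n / (qfact q k * qfact q (n - k)).

Definition Dq (R : realType) (q : R) (f : R -> R) (z : R) : R :=
  if z == 0 then derive1 f 0 else (f (q * z) - f z) / ((q - 1) * z).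

Definition odd_qLidstone_I (R : realType) (q : R) (p : nat -> {poly R}) : Prop :=
  [/\ forall n, (0 < n)%N -> forall z,
        Dq q (Dq q (horner (p n))) z
        = qnum q (2 * n).+1 * qnum q (2 * n) * (p n.-1).[z],
      forall n, (p n).[0] = 0
    & exists2 a0 : R, a0 != 0 & p 0%N = a0 *: 'X].

(* Numerical sequences carry even indices in the source: alpha n stands for
   alpha_{2n}, and beta n for beta_{2n}. *)
Definition related_seq (R : realType) (q : R) (p : nat -> {poly R})
    (alpha : nat -> R) : Prop :=
  forall n, alpha n = Dq q (horner (p n)) 0.

Definition conjugate_seq (R : realType) (q : R) (alpha beta : nat -> R) : Prop :=
  forall n, \sum_(j < n.+1) beta j * alpha (n - j)%N
              / (qfact q (2 * j).+1 * qfact q (2 * (n - j)).+1) = (n == 0%N)%:R.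

Definition qLidstone_poly (R : realType) (q : R) (a : nat -> R) (n : nat) :
    {poly R} :=
  \sum_(k < n.+1) (qbinom q (2 * n).+1 (2 * k).+1
                     * (a (n - k)%N / qnum q (2 * (n - k)).+1)) *: 'X^((2 * k).+1).

(* p and phat are conjugate odd q-Lidstone-type (I) sequences, p being related
   to alpha, and beta being the numerical sequence defining phat. *)
Definition conjugate_qLidstone_I (R : realType) (q : R) (alpha beta : nat -> R)
    (p phat : nat -> {poly R}) : Prop :=
  [/\ odd_qLidstone_I q p, related_seq q p alpha, conjugate_seq q alpha beta
    & forall n, phat n = qLidstone_poly q beta n].

(* Formal power series in t over a ring A are represented by their coefficient
   sequences; here A = {poly R}, the polynomials in z. *)

Definition fps_mul (A : nzRingType) (f g : nat -> A) (n : nat) : A :=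
  \sum_(i < n.+1) f i * g (n - i)%N.

Definition fps_one (A : nzRingType) (n : nat) : A := (n == 0%N)%:R.

(* sum_k c_k t^(2k) / [2k+1]_q! *)
Definition fps_even (R : realType) (q : R) (c : nat -> {poly R}) (n : nat) :
    {poly R} :=
  if odd n then 0 else (qfact q n.+1)^-1 *: c n./2.

Definition sinhq_coef (R : realType) (q : R) (n : nat) : R :=
  if odd n then (qfact q n)^-1 else 0.

(* sinh_q(z t) / t: substituting z t multiplies the n-th coefficient by z^n, and
   dividing by t shifts the coefficients (the constant one is 0). *)
Definition fps_sinhq_div (R : realType) (q : R) (n : nat) : {poly R} :=
  sinhq_coef q n.+1 *: 'X^(n.+1).

(* The complex numbers, bundled as a numClosedFieldType: the topology of
   mathcomp-analysis is attached to (the sort of) numFieldTypes, and is not found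
   on the bare carrier R[i]. *)
Definition Cplx (R : realType) : numClosedFieldType := R[i].

Definition toC (R : realType) (x : R) : Cplx R := real_complex R x.

Definition cpoly (R : realType) (p : {poly R}) (z : Cplx R) : Cplx R :=
  (map_poly (@toC R) p).[z].

(* partial sums of sum_n c_n t^(2n) / [2n+1]_q! *)
Definition even_series (R : realType) (q : R) (c : nat -> Cplx R) (t : Cplx R) :
    nat -> Cplx R :=
  series (fun n => c n * (t ^+ (2 * n) / toC (qfact q (2 * n).+1))).

Definition gq (R : realType) (q : R) (alpha : nat -> R) (t : Cplx R) : Cplx R :=
  limn (even_series q (fun n => toC (alpha n)) t).

Definition sinhq (R : realType) (q : R) (x : Cplx R) : Cplx R :=
  limn (series (fun n => x ^+ (2 * n).+1 / toC (qfact q (2 * n).+1))).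

(* Main.v *)
Require Import Defs.
From mathcomp Require Import all_boot all_order all_algebra.
From mathcomp Require Import complex.
From mathcomp Require Import all_classical all_reals all_analysis.
From mathcomp Require Import ring lra zify.
Import Order.TTheory GRing.Theory Num.Theory.
Import numFieldNormedType.Exports.
Local Open Scope classical_set_scope.
Local Open Scope ring_scope.

(* The recursion D_q^2 p_n = [2n+1]_q [2n]_q p_(n-1) determines all coefficients of
   p_n from the alpha_(2m), so p_n(z) t^(2n) / [2n+1]_q! is the n-th term of the
   Cauchy product of g_q(t) and sinh_q(z t) / t; the same holds for phat_n and the
   beta-series. Since the terms of sinh_q(z t) are dominated by a geometric
   sequence when |z t| < 1 / (1 - q), these products converge by Mertens'
   theorem, even if g_q(t) converges only conditionally. The Cauchy product of the
   alpha- and beta-series is 1, and by Cesaro averaging the product of their sums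
   is 1 wherever both converge. Finally, a geometric bound on the coefficients of a
   power series with nonzero constant term passes to those of its reciprocal. *)

(** * Cauchy products of coefficient sequences *)

Lemma fps_mulC {A : comNzRingType} (f g : nat -> A) :
  fps_mul f g = fps_mul g f.
Proof.
apply/funext => n; rewrite /fps_mul (reindex_inj rev_ord_inj).
by apply: eq_bigr => i _ /=; rewrite subSS subKn ?leq_ord// mulrC.
Qed.

(** Since [series] at n stops before n, taking partial sums is multiplication by t/(1-t), which can
    be moved onto one factor. *)
Lemma series_fps_mul {A : nzRingType} (f g : nat -> A) :
  series (fps_mul f g) = fps_mul f (series g).
Proof.
apply/funext; elim=> [|n IH].
  by rewrite /fps_mul big_ord1 /series /= !big_nil mulr0.
rewrite seriesSr IH /fps_mul [RHS]big_ord_recr /= subnn [series g 0%N]big_nil.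
rewrite mulr0 addr0 -big_split; apply: eq_bigr => i _ /=.
by rewrite subSn ?leq_ord// seriesSr mulrDr.
Qed.

Lemma sum_even_support {V : nmodType} (F : nat -> V) (n : nat) :
  (forall i, odd i -> F i = 0) ->
  \sum_(i < (2 * n).+1) F i = \sum_(i < n.+1) F (2 * i)%N.
Proof.
move=> F0; elim: n => [|n IH]; first by rewrite !big_ord1.
rewrite big_ord_recr [RHS]big_ord_recr /= -IH mulnS add2n big_ord_recr /=.
by rewrite [F (2 * n).+1]F0 ?addr0// /= oddM.
Qed.

(** The coefficients of f(t^2). All series in play except [sinh_q] itself have this form. *)
Definition evenize {A : nzRingType} (f : nat -> A) (n : nat) : A :=
  if odd n then 0 else f n./2.

Lemma fps_mul_evenize {A : nzRingType} (f g : nat -> A) :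
  fps_mul (evenize f) (evenize g) =1 evenize (fps_mul f g).
Proof.
move=> n; rewrite /evenize /fps_mul; case: ifPn => nodd.
  apply: big1 => i _; case: ifPn => iodd; first by rewrite mul0r.
  by rewrite oddB ?nodd ?(negbTE iodd) ?mulr0// -ltnS.
have nE : n = (2 * n./2)%N by rewrite mul2n halfK (negbTE nodd) subn0.
have {nodd} := nE; generalize n./2 => m {}nE; rewrite {}nE.
rewrite (sum_even_support (fun i => (if odd i then 0 else f i./2) *
   (if odd (2 * m - i) then 0 else g (2 * m - i)./2))); last first.
  by move=> i ->; rewrite mul0r.
by apply: eq_bigr => i _; rewrite -mulnBr !mul2n !odd_double !doubleK.
Qed.

Lemma eq_fps_mul {A : nzRingType} (f f' g g' : nat -> A) :
  f =1 f' -> g =1 g' -> fps_mul f g =1 fps_mul f' g'.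
Proof. by move=> ff' gg' n; apply: eq_bigr => i _; rewrite ff' gg'. Qed.

(** * Real and complex sequences *)

Lemma contraction_cvg0 {R : realType} (rho : R) (e d : nat -> R) :
  0 <= rho < 1 -> (forall n, 0 <= e n) ->
  (forall n, e n.+1 <= rho * e n + d n) ->
  d @ \oo --> (0 : R) -> e @ \oo --> (0 : R).
Proof.
move=> /andP[rho0 rho1] e0 rec /cvgr0Pnorm_lt d0.
apply/cvgr0Pnorm_lt => eps eps0.
(* The factor 1 - rho makes eps/2 the fixed point of x |-> rho x + (1 - rho) eps/2, so the bound
   [geo] reproduces itself. *)
have eps' : 0 < (1 - rho) * (eps / 2) by rewrite mulr_gt0 ?subr_gt0 ?divr_gt0.
have [N _ dN] := d0 _ eps'.
have geo m : e (N + m)%N <= rho ^+ m * e N + eps / 2.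
  elim: m => [|m IH]; first by rewrite addn0 expr0 mul1r lerDl ltW// divr_gt0.
  have /ltW dNm : d (N + m)%N < (1 - rho) * (eps / 2).
    by apply: le_lt_trans (ler_norm _) (dN _ _); rewrite /= leq_addr.
  rewrite addnS (le_trans (rec _))// exprS.
  have := ler_wpM2l rho0 IH; lra.
have : (fun m => rho ^+ m * e N) @ \oo --> (0 : R).
  rewrite -(mul0r (e N)); apply: cvgM; last exact: cvg_cst.
  by apply: cvg_expr; rewrite ger0_norm.
move=> /cvgr0Pnorm_lt /(_ (eps / 2)) [|M _ geoM]; first exact: divr_gt0.
exists (N + M)%N => // n /= leNMn.
have := geo (n - N)%N; rewrite subnKC; last by lia.
have /= := geoM (n - N)%N; rewrite ger0_norm ?mulr_ge0 ?exprn_ge0// => H1 H2.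
rewrite ger0_norm//; have := H1 ltac:(lia); lra.
Qed.

(** The convolution e satisfies e_(n+1) = rho e_n + d_(n+1), a contraction with a null
    perturbation. *)
Lemma geometric_conv_cvg0 {R : realType} (rho : R) (d : nat -> R) :
  0 <= rho < 1 -> (forall n, 0 <= d n) -> d @ \oo --> (0 : R) ->
  fps_mul (fun k => rho ^+ k) d @ \oo --> (0 : R).
Proof.
move=> rho01 d0 dcvg; have /andP[rho0 _] := rho01.
apply: (@contraction_cvg0 _ rho _ (fun n => d n.+1)) => //.
- by move=> n; apply: sumr_ge0 => i _; rewrite mulr_ge0 ?exprn_ge0.
- move=> n; rewrite /fps_mul big_ord_recl expr0 mul1r subn0 addrC lerD2r.
  rewrite mulr_sumr le_eqVlt; apply/orP; left; apply/eqP.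
  by apply: eq_bigr => i _; rewrite mulrA -exprS.
- by rewrite (cvg_shiftS d).
Qed.

(** * The complex modulus as a real number, and limits of complex sequences *)

Section ComplexNorm.
Context {R : realType}.
Implicit Types (x y : R) (z w : Cplx R) (u : nat -> Cplx R).

(** The norm of [Cplx R] takes values in [Cplx R]; this real-valued version lets estimates be made
    in [R]. *)
Definition cnorm z : R := Normc.normc z.

Lemma normCE z : `|z| = toC (cnorm z). Proof. by []. Qed.

Lemma toC_le x y : (toC x <= toC y) = (x <= y). Proof. exact: lecR. Qed.
Lemma toC_lt x y : (toC x < toC y) = (x < y). Proof. exact: ltcR. Qed.

Lemma toC_inj : injective (@toC R).
Proof. exact: fmorph_inj. Qed.

Lemma cnorm_ge0 z : 0 <= cnorm z.
Proof. by rewrite -toC_le -normCE -[toC 0]/(0 : Cplx R) normr_ge0. Qed.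

Lemma cnorm0 : cnorm 0 = 0. Proof. exact: Normc.normc0. Qed.

Lemma cnormM z w : cnorm (z * w) = cnorm z * cnorm w.
Proof. exact: Normc.normcM. Qed.

Lemma cnormX z n : cnorm (z ^+ n) = cnorm z ^+ n.
Proof.
elim: n => [|n IH]; first by rewrite !expr0 /cnorm Normc.normc1.
by rewrite !exprS cnormM IH.
Qed.

Lemma cnormV z : cnorm z^-1 = (cnorm z)^-1.
Proof. exact: Normc.normcV. Qed.

Lemma cnorm_toC x : cnorm (toC x) = `|x|.
Proof. by apply: toC_inj; rewrite -normCE normc_def /= expr0n addr0 sqrtr_sqr. Qed.

Lemma cnorm_eq0 z : (cnorm z == 0) = (z == 0).
Proof. by rewrite -(inj_eq toC_inj) -normCE -[toC 0]/(0 : Cplx R) normr_eq0. Qed.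

Lemma cnormD z w : cnorm (z + w) <= cnorm z + cnorm w.
Proof. exact: le_normcD. Qed.

Lemma cnorm_sum (n : nat) (F : 'I_n -> Cplx R) :
  cnorm (\sum_(i < n) F i) <= \sum_(i < n) cnorm (F i).
Proof.
elim: n F => [|n IH] F; first by rewrite !big_ord0 cnorm0.
by rewrite !big_ord_recr (le_trans (cnormD _ _))// lerD2r.
Qed.

Lemma toC_Re (z : Cplx R) : z \is Num.real -> toC (complex.Re z) = z.
Proof. by move=> zr; have := @RRe_real R z zr. Qed.

Lemma cvgC0P u : u @ \oo --> (0 : Cplx R) <-> cnorm \o u @ \oo --> (0 : R).
Proof.
split=> /cvgr0Pnorm_lt u0; apply/cvgr0Pnorm_lt => eps eps0.
  have : 0 < toC eps by rewrite -[0]/(toC 0) toC_lt.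
  move=> /u0; apply: filterS => n.
  by rewrite normCE toC_lt /= ger0_norm ?cnorm_ge0.
(* Here eps is a positive element of [Cplx R], hence real, and is replaced by its real part. *)
have epsE := toC_Re eps (gtr0_real eps0).
rewrite -epsE -[0]/(toC 0) toC_lt in eps0.
have := u0 _ eps0; apply: filterS => n.
by rewrite -epsE normCE toC_lt /= ger0_norm ?cnorm_ge0.
Qed.

Lemma cvgC_bounded u : cvgn u -> exists2 M : R, 0 <= M & forall n, cnorm (u n) <= M.
Proof.
move=> /cvg_seq_bounded [M [Mreal /(_ (M + 1))]].
rewrite ltrDl ltr01 => /(_ isT) /= uM.
have uM' n : `|u n| <= M + 1 by exact: uM.
have ME : toC (complex.Re (M + 1)) = M + 1 by rewrite toC_Re// rpredD ?rpred1.
have {}uM' n : cnorm (u n) <= complex.Re (M + 1).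
  by have := uM' n; rewrite -ME normCE toC_le.
by exists (complex.Re (M + 1)) => //; rewrite (le_trans (cnorm_ge0 (u 0%N))).
Qed.

Lemma cvgCP u z : u @ \oo --> z <-> (fun n => cnorm (u n - z)) @ \oo --> (0 : R).
Proof.
have [H1 H2] := @subr_cvg0 (Cplx R) (Cplx R) nat \oo _ u z.
have [H3 H4] := cvgC0P (fun n => u n - z).
by split=> h; [exact: H3 (H2 h)|exact: H1 (H4 h)].
Qed.

Lemma cvgC_toC (x : nat -> R) (l : R) :
  x @ \oo --> l -> (fun n => toC (x n)) @ \oo --> toC l.
Proof.
move=> xl; apply: (proj2 (cvgCP _ _)).
have -> : (fun n => cnorm (toC (x n) - toC l)) = (fun n => `|x n - l|).
  by apply/funext => n; rewrite -cnorm_toC /toC rmorphB.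
by apply/norm_cvg0P/subr_cvg0.
Qed.

Lemma cvgC_cst z : (fun _ : nat => z) @ \oo --> z.
Proof. exact: (@cvg_cst (Cplx R)). Qed.

Lemma cvgCD u v z w : u @ \oo --> z -> v @ \oo --> w ->
  (fun n => u n + v n) @ \oo --> z + w.
Proof. exact: (@cvgD (Cplx R) (Cplx R) nat \oo _ u v z w). Qed.

Lemma cvgCM u v z w : u @ \oo --> z -> v @ \oo --> w ->
  (fun n => u n * v n) @ \oo --> z * w.
Proof. exact: (@cvgM (Cplx R) nat \oo _ u v z w). Qed.

Lemma cvgC_shiftS u z : u @ \oo --> z -> (fun n => u n.+1) @ \oo --> z.
Proof. by move=> uz; rewrite (@cvg_shiftS (Cplx R) u). Qed.

Lemma cvgC_sub0 u z : u @ \oo --> z -> (fun n => u n - z) @ \oo --> (0 : Cplx R).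
Proof. exact: (proj2 (@subr_cvg0 (Cplx R) (Cplx R) nat \oo _ u z)). Qed.

Lemma cvgC_unique u z w : u @ \oo --> z -> u @ \oo --> w -> z = w.
Proof.
exact: (@cvg_unique (Cplx R) (@norm_hausdorff (Cplx R) (Cplx R)) (u @ \oo) _ z w).
Qed.

Lemma le_cvg0 (e h : nat -> R) :
  (forall n, 0 <= e n <= h n) -> h @ \oo --> (0 : R) -> e @ \oo --> (0 : R).
Proof.
move=> eh; apply: (squeeze_cvgr _ (cvg_cst 0)).
by apply: nearW => n; exact: eh.
Qed.

Lemma le_cnorm_Re z : `|complex.Re z| <= cnorm z.
Proof. by rewrite -toC_le -normCE; exact: normc_ge_Re. Qed.

Lemma le_cnorm_Im z : `|complex.Im z| <= cnorm z.
Proof.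
by case: z => x y; rewrite /cnorm /= -sqrtr_sqr ler_wsqrtr// lerDr sqr_ge0.
Qed.

Lemma geometric_series_cvg (rho M : R) (x : nat -> R) :
  0 <= rho < 1 -> (forall k, `|x k| <= M * rho ^+ k) -> cvgn (series x).
Proof.
move=> /andP[rho0 rho1] xM; apply: normed_cvg.
apply: (series_le_cvg _ _ xM).
- by move=> n; rewrite /= normr_ge0.
- by move=> n; rewrite (le_trans _ (xM n)).
- by apply: is_cvg_geometric_series; rewrite ger0_norm.
Qed.

(** Real and imaginary parts obey the same geometric bound, so both real series converge. *)
Lemma geometric_series_cvgC (rho M : R) u :
  0 <= rho < 1 -> (forall k, cnorm (u k) <= M * rho ^+ k) -> cvgn (series u).
Proof.
move=> rho01 uM.
have /cvgC_toC cRe : cvgn (series (fun k => complex.Re (u k))).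
  by apply: (geometric_series_cvg _ M _ rho01) => k;
    rewrite (le_trans (le_cnorm_Re _)).
have /cvgC_toC cIm : cvgn (series (fun k => complex.Im (u k))).
  by apply: (geometric_series_cvg _ M _ rho01) => k;
    rewrite (le_trans (le_cnorm_Im _)).
have -> : series u = (fun n => toC (series (fun k => complex.Re (u k)) n) +
    ('i%C : Cplx R) * toC (series (fun k => complex.Im (u k)) n)).
  by apply/funext => n; rewrite /series /= [LHS]complexE /toC !raddf_sum.
exact: cvgP (cvgCD _ _ _ _ cRe (cvgCM _ _ _ _ (cvgC_cst _) cIm)).
Qed.

End ComplexNorm.

(** * Limits of Cauchy products of complex series *)

Section Products.
Context {R : realType}.
Implicit Types (a b : nat -> Cplx R) (A B : Cplx R).

Lemma fps_mul_cvg0 (rho M : R) b d :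
  0 <= rho < 1 -> (forall k, cnorm (b k) <= M * rho ^+ k) ->
  d @ \oo --> (0 : Cplx R) -> fps_mul b d @ \oo --> (0 : Cplx R).
Proof.
move=> rho01 bM dcvg; have d0 := proj1 (cvgC0P _) dcvg.
apply: (proj2 (cvgC0P _)).
have geo := geometric_conv_cvg0 rho _ rho01 (fun n => cnorm_ge0 (d n)) d0.
have ub : (fun n => M * fps_mul (fun k => rho ^+ k) (cnorm \o d) n) @ \oo --> (0 : R).
  by rewrite -(mulr0 M); apply: cvgM; [exact: cvg_cst|exact: geo].
apply: (le_cvg0 _ _ _ ub) => n; rewrite cnorm_ge0 /=.
rewrite (le_trans (cnorm_sum _ _))// mulr_sumr.
by apply: ler_sum => i _; rewrite cnormM mulrA ler_wpM2r// cnorm_ge0.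
Qed.

Lemma mertens_geometric (rho M : R) a b A B :
  0 <= rho < 1 -> (forall k, cnorm (b k) <= M * rho ^+ k) ->
  series a @ \oo --> A -> series b @ \oo --> B ->
  series (fps_mul a b) @ \oo --> A * B.
Proof.
move=> rho01 bM aA bB; rewrite fps_mulC series_fps_mul.
(* Each partial sum of a is A plus a null remainder; convolving the remainder with the geometrically
   bounded b gives a null sequence. *)
have -> : fps_mul b (series a) =
    (fun n => A * series b n.+1 + fps_mul b (fun k => series a k - A) n).
  apply/funext => n; rewrite /series /= big_mkord mulr_sumr -big_split/=.
  by apply: eq_bigr => i _; rewrite mulrBr [A * _]mulrC addrC subrK.
rewrite -[A * B]addr0; apply: cvgCD.
  apply: cvgCM; first exact: cvgC_cst.
  exact: (cvgC_shiftS _ _ bB).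
apply: (fps_mul_cvg0 rho M _ _ rho01 bM).
exact: (cvgC_sub0 _ _ aA).
Qed.

Lemma cesaro_cvg0 (v : nat -> Cplx R) :
  v @ \oo --> (0 : Cplx R) ->
  (fun n => \sum_(k < n.+1) cnorm (v k) / n.+1%:R) @ \oo --> (0 : R).
Proof.
move=> v0; have {}v0 := proj1 (cvgC0P _) v0.
have := cesaro v0; rewrite /arithmetic_mean /=.
have -> // : (fun n => n.+1%:R^-1 * series (cnorm \o v) n.+1) =
  (fun n => \sum_(k < n.+1) cnorm (v k) / n.+1%:R).
by apply/funext => n; rewrite /series /= big_mkord -mulr_suml mulrC.
Qed.

(* The averages of A_k B_(n-k) tend to A B even when neither series converges
   absolutely: A_k B_(n-k) - A B = (A_k - A) B_(n-k) + A (B_(n-k) - B), and each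
   summand has null averages. *)
Lemma cesaro_fps_mul (u v : nat -> Cplx R) A B :
  u @ \oo --> A -> v @ \oo --> B ->
  (fun n => fps_mul u v n / toC n.+1%:R) @ \oo --> A * B.
Proof.
move=> uA vB.
have [M M0 vM] := cvgC_bounded v (cvgP _ vB).
have uA0 : (fun n => u n - A) @ \oo --> (0 : Cplx R).
  exact: (cvgC_sub0 _ _ uA).
have vB0 : (fun n => v n - B) @ \oo --> (0 : Cplx R).
  exact: (cvgC_sub0 _ _ vB).
have ub : (fun n => M * (\sum_(k < n.+1) cnorm (u k - A) / n.+1%:R) +
    cnorm A * (\sum_(k < n.+1) cnorm (v k - B) / n.+1%:R)) @ \oo --> (0 : R).
  have cu := cvgM (cvg_cst M) (cesaro_cvg0 _ uA0).
  have cv := cvgM (cvg_cst (cnorm A)) (cesaro_cvg0 _ vB0).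
  rewrite mulr0 in cu; rewrite mulr0 in cv.
  by have := cvgD (cu _ _) (cv _ _); rewrite addr0; apply.
apply: (proj2 (cvgCP _ _)).
apply: (le_cvg0 _ _ _ ub) => n; rewrite cnorm_ge0 /=.
have -> : fps_mul u v n / toC n.+1%:R - A * B =
    (\sum_(k < n.+1) (u k - A) * v (n - k)%N
     + A * \sum_(k < n.+1) (v k - B)) / toC n.+1%:R.
  have n0 : toC n.+1%:R != 0 :> Cplx R.
    by rewrite -cnorm_eq0 cnorm_toC normr_eq0 pnatr_eq0.
  apply: (mulIf n0); rewrite mulrBl !divfK//.
  have -> : \sum_(k < n.+1) (v k - B) = \sum_(k < n.+1) (v (n - k)%N - B).
    by rewrite (reindex_inj rev_ord_inj).
  rewrite mulr_sumr -big_split /=.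
  rewrite (eq_bigr (fun k : 'I_n.+1 => u k * v (n - k)%N - A * B)); last first.
    by move=> k _; ring.
  by rewrite sumrB sumr_const card_ord /toC rmorph_nat mulr_natr.
rewrite cnormM cnormV cnorm_toC normr_nat -!mulr_suml !mulrA -mulrDl.
rewrite ler_wpM2r ?invr_ge0// (le_trans (cnormD _ _))// lerD//.
  rewrite (le_trans (cnorm_sum _ _))// mulr_sumr ler_sum// => k _.
  by rewrite cnormM mulrC ler_wpM2r ?cnorm_ge0.
by rewrite cnormM ler_wpM2l ?cnorm_ge0// cnorm_sum.
Qed.

(** Convolving the two sequences of partial sums gives t^2/(1-t)^2, whose n-th coefficient is n - 1
    (and 0 at n = 0). Dividing by n + 1 gives averages tending both to A B and to 1. *)
Lemma series_reciprocal_cvg a b A B :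
  fps_mul a b =1 @fps_one (Cplx R) ->
  series a @ \oo --> A -> series b @ \oo --> B -> A * B = 1.
Proof.
move=> ab1 aA bB.
have := cesaro_fps_mul _ _ _ _ aA bB.
have sone n : series (fps_mul a b) n.+1 = 1.
  by rewrite /series /= big_nat_recl// ab1 big1 ?addr0//.
have sn n : fps_mul (series a) (series b) n = toC n.-1%:R.
  rewrite -series_fps_mul fps_mulC -series_fps_mul fps_mulC.
  elim: n => [|n IH]; first by rewrite /series /= big_nil.
  rewrite seriesSr IH; case: n {IH} => [|n].
    by rewrite /series /= big_nil addr0.
  by rewrite sone /toC !rmorph_nat natr1.
have -> : (fun n => fps_mul (series a) (series b) n / toC n.+1%:R) =
    (fun n => toC (n.-1%:R / n.+1%:R)).
  by apply/funext => n; rewrite sn /toC fmorph_div.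
move=> lim1.
have lim2 : (fun n => toC (n.-1%:R / n.+1%:R)) @ \oo --> (1 : Cplx R).
  suff : (fun n => n.-1%:R / n.+1%:R) @ \oo --> (1 : R) by exact: cvgC_toC.
  apply/cvgrPdist_le => e e0.
  (* The tolerance e/2 suits 1 - n/(n+2) = 2/(n+2). *)
  have [N _ hN] := near_infty_natSinv_lt (PosNum (divr_gt0 e0 (ltr0Sn R 1))).
  exists N.+1 => // -[//|n] /= Nn; have /= := hN n.+1 ltac:(rewrite /=; lia).
  have -> : 1 - n%:R / n.+2%:R = 2%:R * (n.+2%:R^-1) :> R.
    by rewrite -(natr1 n.+1) -(natr1 n); field; rewrite !natr1 pnatr_eq0.
  by rewrite ger0_norm ?mulr_ge0//; move: (n.+2%:R^-1 : R) => y /ltW; lra.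
exact: cvgC_unique _ _ _ lim1 lim2.
Qed.

End Products.

(** * q-Lidstone polynomials as formal objects *)

(** The difference vanishes at the distinct points 0, 1, 2, ..., as many as its size, hence is
    zero. *)
Lemma horner_inj {F : numDomainType} (f g : {poly F}) :
  (forall z, f.[z] = g.[z]) -> f = g.
Proof.
move=> fg; apply/eqP; rewrite -subr_eq0; apply/eqP.
apply: (@roots_geq_poly_eq0 _ _ [seq i%:R | i <- iota 0 (size (f - g))]).
- by apply/allP => z _; rewrite /root hornerD hornerN fg subrr.
- by rewrite map_inj_uniq ?iota_uniq// => i j /eqP; rewrite eqr_nat => /eqP.
- by rewrite size_map size_iota.
Qed.

Section Formal.
Context {R : realType} (q : R).
Hypotheses (q0 : 0 < q) (q1 : q < 1).

Lemma qnum_gt0 m : (0 < m)%N -> 0 < qnum q m.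
Proof.
by move=> m0; rewrite divr_gt0 ?subr_gt0// exprn_ilt1 ?ltW// -lt0n.
Qed.

Lemma qnum_neq0 m : (0 < m)%N -> qnum q m != 0.
Proof. by move=> m0; rewrite gt_eqF ?qnum_gt0. Qed.

Lemma qfactS m : qfact q m.+1 = qfact q m * qnum q m.+1.
Proof. by rewrite /qfact big_nat_recr. Qed.

Lemma qfact_gt0 m : 0 < qfact q m.
Proof.
elim: m => [|m IH]; first by rewrite /qfact big_nil.
by rewrite qfactS mulr_gt0 ?qnum_gt0.
Qed.

Lemma qfact_neq0 m : qfact q m != 0.
Proof. by rewrite gt_eqF ?qfact_gt0. Qed.

Lemma qnum1 : qnum q 1 = 1.
Proof. by rewrite /qnum expr1 divff// subr_eq0 gt_eqF. Qed.

Lemma qfact1 : qfact q 1 = 1.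
Proof. by rewrite /qfact big_nat1 qnum1. Qed.

Definition Dq_poly (f : {poly R}) : {poly R} :=
  \poly_(i < size f) (qnum q i.+1 * f`_i.+1).

Lemma coef_Dq_poly (f : {poly R}) i : (Dq_poly f)`_i = qnum q i.+1 * f`_i.+1.
Proof.
rewrite coef_poly; case: ltnP => // fi.
by rewrite nth_default ?mulr0// (leq_trans fi).
Qed.

Lemma Dq_horner (f : {poly R}) : Dq q (horner f) = horner (Dq_poly f).
Proof.
apply/funext => z; rewrite /Dq; case: eqVneq => [->|z0].
  rewrite derive1E (@derive_val _ _ _ _ _ _ _ (is_derive_poly f 0)).
  rewrite !horner_coef0 coef_deriv coef_Dq_poly /qnum expr1 divff ?mul1r//.
  by rewrite subr_eq0 gt_eqF.
have qz0 : (q - 1) * z != 0 by rewrite mulf_neq0// subr_eq0 lt_eqF.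
apply: (mulIf qz0); rewrite divfK//.
rewrite [(Dq_poly f).[z]](@horner_coef_wide _ (size f)) ?size_poly//.
rewrite !horner_coef -sumrB mulr_suml.
(* The constant term of f(qz) - f(z) cancels, and the last term on the right vanishes because f has
   no coefficient at index [size f]; the remaining terms match one by one. *)
case: (size f) (@nth_default _ 0 f (size f) (leqnn _)) => [|n] fn.
  by rewrite !big_ord0.
rewrite big_ord_recl !expr0 subrr add0r [RHS]big_ord_recr/=.
rewrite coef_Dq_poly fn mulr0 !mul0r addr0.
apply: eq_bigr => i _; rewrite coef_Dq_poly /qnum exprMn.
have q1' : 1 - q != 0 by rewrite subr_eq0 gt_eqF.
by rewrite /bump /= add1n [z ^+ i.+1]exprS [q ^+ i.+1]exprS; field.
Qed.

Lemma qLidstone_rec (p : nat -> {poly R}) (n : nat) :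
  odd_qLidstone_I q p ->
  Dq_poly (Dq_poly (p n.+1)) =
    (qnum q (2 * n.+1).+1 * qnum q (2 * n.+1)) *: p n.
Proof.
move=> [rec _ _]; apply: horner_inj => z.
by rewrite hornerZ -Dq_horner -Dq_horner rec.
Qed.

Lemma related_seqE (p : nat -> {poly R}) (alpha : nat -> R) (n : nat) :
  related_seq q p alpha -> alpha n = (p n)`_1.
Proof.
move=> ->.
by rewrite Dq_horner horner_coef0 coef_Dq_poly qnum1 mul1r.
Qed.

(* The normalised coefficients [i]_q! (p n)`_i / [2n+1]_q! turn the recursion
   into the shift (n, i) |-> (n - 1, i - 2). *)
Lemma qLidstone_coef (p : nat -> {poly R}) (alpha : nat -> R) (n i : nat) :
  odd_qLidstone_I q p -> related_seq q p alpha ->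
  qfact q i * (p n)`_i / qfact q (2 * n).+1 =
  if odd i && (i <= (2 * n).+1)%N
  then alpha (n - i./2)%N / qfact q (2 * (n - i./2)).+1 else 0.
Proof.
move=> pL rel; have [_ p0 [a0 _ pa0]] := pL.
have c0 m : (p m)`_0 = 0 by rewrite -horner_coef0 p0.
elim: n i => [|n IH] i.
  rewrite muln0 qfact1 divr1; case: i => [|[|i]].
  - by rewrite c0 mulr0.
  - by rewrite qfact1 /= divr1 mul1r (related_seqE _ _ _ rel).
  - by rewrite pa0 coefZ coefX /= !mulr0 andbF.
case: i => [|[|i]].
- by rewrite c0 mulr0 mul0r.
- by rewrite qfact1 subn0 mul1r (related_seqE _ _ _ rel).
have -> : odd i.+2 && (i.+2 <= (2 * n.+1).+1)%N = odd i && (i <= (2 * n).+1)%N.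
  by rewrite /= negbK; congr andb; lia.
rewrite [(i.+2)./2]/= subSS -IH.
(* Comparing coefficients gives [i+1]_q [i+2]_q (p_(n+1))_(i+2) = [2n+3]_q [2n+2]_q (p_n)_i, whose
   factors are those by which the factorials grow. *)
have := congr1 (fun f : {poly R} => f`_i) (qLidstone_rec p n pL).
rewrite !coef_Dq_poly coefZ mulnS add2n => E.
rewrite !qfactS.
have := qfact_neq0 (2 * n).+1; have := qfact_neq0 (2 * n); have := qnum_neq0 (2 * n).+1 isT.
have := qnum_neq0 (2 * n).+2 isT; have := qnum_neq0 (2 * n).+3 isT => h1 h2 h3 h4 h5.
rewrite -[qfact q i * _ * _ * _]mulrA -[qfact q i * _ * _]mulrA.
rewrite [qnum q i.+1 * (_ * _)]E.
by field; rewrite ?h1 ?h2 ?h3 ?h4.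
Qed.

(** * Generating functions as formal power series *)

(** The right-hand side is the n-th coefficient of a Cauchy product in t^2. Both p and phat are
    brought to this form, the only input about them in the formal and in the analytic identities. *)
Lemma qLidstone_term (p : nat -> {poly R}) (alpha : nat -> R) (n : nat) :
  odd_qLidstone_I q p -> related_seq q p alpha ->
  (qfact q (2 * n).+1)^-1 *: p n =
  \sum_(k < n.+1) (alpha (n - k)%N / qfact q (2 * (n - k)).+1
                     / qfact q (2 * k).+1) *: 'X^((2 * k).+1).
Proof.
move=> pL rel; apply/polyP => i; rewrite coefZ coef_sum.
have -> : (qfact q (2 * n).+1)^-1 * (p n)`_i =
    (qfact q i * (p n)`_i / qfact q (2 * n).+1) / qfact q i.
  by field; rewrite !qfact_neq0.
rewrite (qLidstone_coef _ _ _ _ pL rel); case: ifPn => [/andP[iodd lein]|].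
  have iE : i = (2 * i./2).+1 by lia.
  have ltin : (i./2 < n.+1)%N by lia.
  rewrite (bigD1 (Ordinal ltin))//= big1 ?addr0 => [|k /eqP kE].
    by rewrite -iE coefZ coefXn eqxx mulr1.
  rewrite coefZ coefXn; case: eqP => [ik|]; last by rewrite mulr0.
  by case: kE; apply/val_inj => /=; lia.
move=> Ni; rewrite mul0r big1// => k _; rewrite coefZ coefXn.
case: eqP => [ik|]; last by rewrite mulr0.
by case/negP: Ni; have := ltn_ord k; lia.
Qed.

(** The binomial cancels [2n+1]_q!, and its [2(n-k)]_q! merges with the denominator [2(n-k)+1]_q
    into one factorial. *)
Lemma qLidstone_poly_term (beta : nat -> R) (n : nat) :
  (qfact q (2 * n).+1)^-1 *: qLidstone_poly q beta n =
  \sum_(k < n.+1) (beta (n - k)%N / qfact q (2 * (n - k)).+1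
                     / qfact q (2 * k).+1) *: 'X^((2 * k).+1).
Proof.
rewrite scaler_sumr; apply: eq_bigr => k _; rewrite scalerA; congr (_ *: _).
have := ltn_ord k; rewrite ltnS /qbinom => lekn.
have -> : ((2 * n).+1 - (2 * k).+1 = 2 * (n - k))%N by lia.
by rewrite [qfact q (2 * (n - k)).+1]qfactS; field; rewrite !qfact_neq0 qnum_neq0.
Qed.

Lemma fps_evenE (c : nat -> {poly R}) :
  fps_even q c =1 evenize (fun n => (qfact q (2 * n).+1)^-1 *: c n).
Proof.
by move=> n; rewrite /fps_even /evenize; case: ifPn => // nodd;
  rewrite mul2n even_halfK.
Qed.

Lemma fps_sinhq_divE :
  fps_sinhq_div q =1
  evenize (fun n => (qfact q (2 * n).+1)^-1 *: 'X^((2 * n).+1)).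
Proof.
move=> n; rewrite /fps_sinhq_div /sinhq_coef /evenize /=.
case: (boolP (odd n)) => nodd /=; first by rewrite scale0r.
by rewrite mul2n even_halfK.
Qed.

Lemma fps_even_mul_sinhq (a : nat -> R) (f : nat -> {poly R}) :
  (forall n, (qfact q (2 * n).+1)^-1 *: f n =
    \sum_(k < n.+1) (a (n - k)%N / qfact q (2 * (n - k)).+1
                     / qfact q (2 * k).+1) *: 'X^((2 * k).+1)) ->
  fps_mul (fps_even q (fun n => (a n)%:P)) (fps_sinhq_div q) =1 fps_even q f.
Proof.
move=> fE n; rewrite (eq_fps_mul _ _ _ _ (fps_evenE _) fps_sinhq_divE).
rewrite fps_mul_evenize fps_evenE /evenize; case: ifP => // _; rewrite fE.
rewrite fps_mulC; apply: eq_bigr => i _ /=.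
rewrite -scalerAl -scalerAr mulrC mul_polyC !scalerA.
by congr (_ *: _); rewrite mulrC [_^-1 * _]mulrC mulrA.
Qed.

Lemma fps_even_mul_conj (alpha beta : nat -> R) :
  conjugate_seq q alpha beta ->
  fps_mul (fps_even q (fun n => (alpha n)%:P))
          (fps_even q (fun n => (beta n)%:P)) =1 @fps_one {poly R}.
Proof.
move=> ab n; rewrite (eq_fps_mul _ _ _ _ (fps_evenE _) (fps_evenE _)).
rewrite fps_mul_evenize /evenize /fps_one; case: ifPn => nodd.
  by case: n nodd.
have -> : (n == 0%N) = (n./2 == 0%N) by lia.
rewrite -polyC_natr -ab fps_mulC rmorph_sum.
apply: eq_bigr => i _ /=.
rewrite -scalerAl -scalerAr -polyCM -!mul_polyC -!polyCM.
by congr _%:P; field; rewrite !qfact_neq0.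
Qed.

End Formal.

(** * Convergence *)

Lemma ratio_geometric {R : realType} (w : nat -> R) (rho : R) (N : nat) :
  0 < rho -> (forall m, 0 <= w m) ->
  (forall m, (N <= m)%N -> w m.+1 <= rho * w m) ->
  exists M, forall m, w m <= M * rho ^+ m.
Proof.
(* This sum dominates each quotient w_i / rho^i with i <= N; past N the ratio bound takes over. *)
move=> rho0 w0 ratio; exists (\sum_(i < N.+1) w i / rho ^+ i).
have wN m : (m <= N)%N -> w m <= (\sum_(i < N.+1) w i / rho ^+ i) * rho ^+ m.
  rewrite -ltnS => mN; rewrite -ler_pdivrMr ?exprn_gt0//.
  rewrite (bigD1 (Ordinal mN))//= lerDl sumr_ge0// => i _.
  by rewrite divr_ge0 ?exprn_ge0// ltW.
elim=> [|m IH]; first exact: wN.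
have [/wN//|Nm] := leqP m.+1 N.
rewrite (le_trans (ratio _ Nm))// exprS mulrCA.
by apply: ler_wpM2l => //; exact: ltW.
Qed.

(* The rate r (1 + M |b 0|) makes the recursion b_n = - b_0 sum_(j < n) b_j a_(n-j)
   telescope through a geometric sum. *)
Lemma reciprocal_coef_bound {R : realType} (a b : nat -> R) (M r : R) :
  0 <= r -> (forall n, `|a n| <= M * r ^+ n) -> fps_mul a b =1 @fps_one R ->
  forall n, `|b n| <= `|b 0%N| * (r * (1 + M * `|b 0%N|)) ^+ n.
Proof.
move=> r0 aM ab1 n; set c := 1 + M * `|b 0%N|.
have M0 : 0 <= M by have := aM 0%N; rewrite expr0 mulr1; apply: le_trans.
have c0 : 0 <= c by rewrite addr_ge0// mulr_ge0.
have ab0 : a 0%N * b 0%N = 1 by have := ab1 0%N; rewrite /fps_mul big_ord1.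
elim/ltn_ind: n => -[|n] IH; first by rewrite expr0 mulr1.
have bS : b n.+1 = - b 0%N * \sum_(i < n.+1) b i * a (n.+1 - i)%N.
  have := ab1 n.+1; rewrite fps_mulC /fps_mul big_ord_recr /= subnn => E.
  have {}E : \sum_(i < n.+1) b i * a (n.+1 - i)%N = - (b n.+1 * a 0%N).
    by apply/eqP; rewrite -addr_eq0; apply/eqP.
  by rewrite E mulrNN mulrCA [b 0%N * _]mulrC ab0 mulr1.
rewrite bS normrM normrN ler_wpM2l// (le_trans (ler_norm_sum _ _ _))//.
apply: (@le_trans _ _ (\sum_(i < n.+1) r ^+ n.+1 * (M * `|b 0%N|) * c ^+ i)).
  apply: ler_sum => i _; rewrite normrM.
  have -> : r ^+ n.+1 * (M * `|b 0%N|) * c ^+ i =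
      `|b 0%N| * (r * c) ^+ i * (M * r ^+ (n.+1 - i)).
    rewrite -{1}(subnKC (ltnW (ltn_ord i))) exprD exprMn; ring.
  by apply: ler_pM => //; exact: IH.
rewrite -mulr_sumr -mulrA.
have -> : M * `|b 0%N| * \sum_(i < n.+1) c ^+ i = c ^+ n.+1 - 1.
  by rewrite subrX1; congr (_ * _); rewrite /c; ring.
by rewrite exprMn ler_wpM2l ?exprn_ge0// gerBl.
Qed.

(** * Generating functions at complex arguments, and the radius of convergence of 1/g_q *)

Section Analytic.
Context {R : realType} (q : R).
Hypotheses (q0 : 0 < q) (q1 : q < 1).
Implicit Types (z t : Cplx R) (c : nat -> R) (f : nat -> {poly R}).

Lemma qfactC_neq0 m : toC (qfact q m) != 0.
Proof. by rewrite -cnorm_eq0 cnorm_toC normr_eq0 qfact_neq0. Qed.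

(** Consecutive terms have ratio x (1-q) / (1 - q^(m+1)), which tends to x (1-q) < 1. *)
Lemma qexp_geometric (x : R) : 0 <= x -> x < (1 - q)^-1 ->
  exists rho M : R, [/\ 0 <= rho, rho < 1 &
    forall m, x ^+ m / qfact q m <= M * rho ^+ m].
Proof.
move=> x0; have p0 : 0 < 1 - q by rewrite subr_gt0.
rewrite -[(1 - q)^-1]mul1r ltr_pdivlMr// => x1.
have y0 : 0 <= x * (1 - q) by rewrite mulr_ge0// ltW.
(* With rho midway between y and 1, q^(m+1) < rho - y suffices for y <= rho (1 - q^(m+1)). *)
set y := x * (1 - q) in x1 y0; pose rho := (y + 1) / 2.
have rho0 : 0 < rho by rewrite /rho; lra.
have yrho : y < rho by rewrite /rho; lra.
have rho1 : rho < 1 by rewrite /rho; lra.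
have : (fun m => q ^+ m) @ \oo --> (0 : R).
  by apply: cvg_expr; rewrite ger0_norm// ltW.
move=> /cvgr0Pnorm_lt /(_ (rho - y)); rewrite subr_gt0 => /(_ yrho) [N _ qN].
have [M wM] : exists M, forall m, x ^+ m / qfact q m <= M * rho ^+ m.
  apply: (ratio_geometric _ rho N rho0) => [m|m Nm].
    by rewrite divr_ge0 ?exprn_ge0// ltW// qfact_gt0.
  have qm0 : 0 < 1 - q ^+ m.+1 by rewrite subr_gt0 exprn_ilt1// ltW.
  have -> : x ^+ m.+1 / qfact q m.+1 =
      y / (1 - q ^+ m.+1) * (x ^+ m / qfact q m).
    rewrite qfactS /qnum exprS /y; field.
    by rewrite qfact_neq0// !gt_eqF.
  apply: ler_wpM2r; first by rewrite divr_ge0 ?exprn_ge0// ltW// qfact_gt0.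
  rewrite ler_pdivrMr//.
  have qs0 : 0 <= q ^+ m.+1 by rewrite exprn_ge0// ltW.
  have /= := qN m.+1 (leqW Nm); rewrite ger0_norm// => qs.
  by have := ler_wpM2r qs0 (ltW rho1); lra.
by exists rho, M; split => //; exact: ltW.
Qed.

Definition even_term c t (n : nat) : Cplx R :=
  toC (c n) * (t ^+ (2 * n) / toC (qfact q (2 * n).+1)).

(** Dividing by t inside the term leaves t^(2k) for nonzero t, which pairs with the powers in
    [even_term]. *)
Definition sinhq_term z t (k : nat) : Cplx R :=
  (z * t) ^+ (2 * k).+1 / toC (qfact q (2 * k).+1) / t.

Lemma even_series_poly c f z t : t != 0 ->
  (forall n, (qfact q (2 * n).+1)^-1 *: f n =
    \sum_(k < n.+1) (c (n - k)%N / qfact q (2 * (n - k)).+1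
                     / qfact q (2 * k).+1) *: 'X^((2 * k).+1)) ->
  even_series q (fun n => cpoly (f n) z) t =
  series (fps_mul (even_term c t) (sinhq_term z t)).
Proof.
move=> t0 fE; congr series; apply/funext => n.
have -> : cpoly (f n) z * (t ^+ (2 * n) / toC (qfact q (2 * n).+1)) =
    cpoly ((qfact q (2 * n).+1)^-1 *: f n) z * t ^+ (2 * n).
  rewrite /cpoly /toC map_polyZ hornerZ fmorphV /=.
  by rewrite mulrA mulrAC [X in X * _]mulrC.
rewrite fE fps_mulC /cpoly /toC rmorph_sum horner_sum mulr_suml.
apply: eq_bigr => k _; rewrite /= map_polyZ hornerZ map_polyXn hornerXn.
rewrite /sinhq_term /even_term /toC !fmorph_div /=.
have nE : (2 * n = 2 * (n - k) + 2 * k)%N.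
  by rewrite -mulnDr subnK// -ltnS.
rewrite {1}nE exprD exprMn [t ^+ (2 * k).+1]exprS.
have := qfactC_neq0 (2 * k).+1; have := qfactC_neq0 (2 * (n - k)).+1.
by rewrite /toC /= => h1 h2; field; rewrite h1 h2 t0.
Qed.

Lemma sinhq_term_cvg z t : t != 0 -> `|z * t| < toC ((1 - q)^-1) ->
  exists rho M : R, [/\ 0 <= rho < 1,
    forall k, cnorm (sinhq_term z t k) <= M * rho ^+ k &
    series (sinhq_term z t) @ \oo --> sinhq q (z * t) / t].
Proof.
move=> t0; rewrite normCE toC_lt => /(qexp_geometric _ (cnorm_ge0 _)).
move=> [rho [M [rho0 rho1 wM]]].
(* Only the exponents 2k+1 occur, and rho^(2k+1) = rho (rho^2)^k. *)
have rho2 : 0 <= rho ^+ 2 < 1 by rewrite exprn_ge0//= exprn_ilt1.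
pose u k := (z * t) ^+ (2 * k).+1 / toC (qfact q (2 * k).+1).
have uM k : cnorm (u k) <= M * rho * (rho ^+ 2) ^+ k.
  rewrite /u cnormM cnormV cnormX cnorm_toC gtr0_norm ?qfact_gt0//.
  by rewrite (le_trans (wM _))// -mulrA -exprM -exprS.
exists (rho ^+ 2), (M * rho / cnorm t); split=> // [k|].
  rewrite /sinhq_term cnormM cnormV mulrAC ler_wpM2r ?invr_ge0 ?cnorm_ge0//.
  exact: uM.
have -> : series (sinhq_term z t) = (fun n => series u n * t^-1).
  by apply/funext => n; rewrite /series /= mulr_suml.
have ucvg := geometric_series_cvgC _ _ _ rho2 uM.
exact: cvgCM _ _ _ _ ucvg (cvgC_cst t^-1).
Qed.

Lemma even_series_mul c f z t (G : Cplx R) : t != 0 -> `|z * t| < toC ((1 - q)^-1) ->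
  (forall n, (qfact q (2 * n).+1)^-1 *: f n =
    \sum_(k < n.+1) (c (n - k)%N / qfact q (2 * (n - k)).+1
                     / qfact q (2 * k).+1) *: 'X^((2 * k).+1)) ->
  even_series q (fun n => toC (c n)) t @ \oo --> G ->
  even_series q (fun n => cpoly (f n) z) t @ \oo --> G * (sinhq q (z * t) / t).
Proof.
move=> t0 zt fE cG; rewrite (even_series_poly c _ _ _ t0 fE).
have [rho [M [rho01 sM scvg]]] := sinhq_term_cvg z t t0 zt.
exact: (mertens_geometric rho M _ _ _ _ rho01 sM cG scvg).
Qed.

Lemma even_term_conj (alpha beta : nat -> R) t :
  conjugate_seq q alpha beta ->
  fps_mul (even_term alpha t) (even_term beta t) =1 @fps_one (Cplx R).
Proof.
move=> ab n; rewrite fps_mulC.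
transitivity (toC (n == 0%N)%:R * t ^+ (2 * n)).
  rewrite -ab /toC rmorph_sum mulr_suml; apply: eq_bigr => i _.
  have nE : (2 * n = 2 * i + 2 * (n - i))%N.
    by rewrite -mulnDr subnKC// -ltnS.
  rewrite [in RHS]nE exprD /even_term /toC !rmorphM fmorphV rmorphM /=.
  have := qfactC_neq0 (2 * i).+1; have := qfactC_neq0 (2 * (n - i)).+1.
  by rewrite /toC /= => h1 h2; field; rewrite h1 h2.
rewrite /fps_one /toC rmorph_nat; case: eqP => [->|_]; last by rewrite mul0r.
by rewrite muln0 expr0 mulr1.
Qed.

Lemma gq_reciprocal (alpha beta : nat -> R) t :
  conjugate_seq q alpha beta ->
  cvgn (even_series q (fun n => toC (alpha n)) t) ->
  cvgn (even_series q (fun n => toC (beta n)) t) ->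
  gq q alpha t != 0 /\
  even_series q (fun n => toC (beta n)) t @ \oo --> (gq q alpha t)^-1.
Proof.
move=> ab calpha cbeta.
have AB : gq q alpha t * limn (even_series q (fun n => toC (beta n)) t) = 1.
  exact: (series_reciprocal_cvg _ _ _ _ (even_term_conj _ _ t ab) calpha cbeta).
have g0 : gq q alpha t != 0.
  by apply: contra_eq_neq AB => ->; rewrite mul0r eq_sym oner_eq0.
split; first exact: g0.
have -> : (gq q alpha t)^-1 = limn (even_series q (fun n => toC (beta n)) t).
  by apply: (mulfI g0); rewrite AB mulfV.
exact: cbeta.
Qed.

Lemma even_series_geometric_cvg c t (M r : R) :
  0 <= r -> r * cnorm t ^+ 2 < 1 ->
  (forall n, `|c n / qfact q (2 * n).+1| <= M * r ^+ n) ->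
  cvgn (even_series q (fun n => toC (c n)) t).
Proof.
move=> r0 rt cM.
apply: (geometric_series_cvgC (r * cnorm t ^+ 2) M) => [|n].
  by rewrite rt mulr_ge0 ?exprn_ge0 ?cnorm_ge0.
rewrite !cnormM cnormV cnormX !cnorm_toC mulrCA -normfV -normrM.
by rewrite [leLHS]mulrC exprMn -exprM mulrA ler_wpM2r ?exprn_ge0 ?cnorm_ge0.
Qed.

(** The terms of a convergent series are bounded; dividing by |t|^(2n) gives the rate. *)
Lemma even_series_coef_bound c t : t != 0 ->
  cvgn (even_series q (fun n => toC (c n)) t) ->
  exists M : R, forall n,
    `|c n / qfact q (2 * n).+1| <= M * ((cnorm t ^+ 2)^-1) ^+ n.
Proof.
move=> t0 ct.
have [M M0 cM] := cvgC_bounded _ (cvgP _ (@cvg_series_cvg_0 (Cplx R) (Cplx R) _ ct)).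
exists M => n; have := cM n.
rewrite !cnormM cnormV cnormX !cnorm_toC mulrCA -normfV -normrM.
rewrite exprVn -exprM mulrC ler_pdivlMr// exprn_gt0// lt_neqAle cnorm_ge0.
by rewrite eq_sym cnorm_eq0 t0.
Qed.

Lemma gq_reciprocal_radius (alpha beta : nat -> R) :
  conjugate_seq q alpha beta ->
  (exists2 t0 : Cplx R,
     t0 != 0 & cvgn (even_series q (fun n => toC (alpha n)) t0)) ->
  exists2 r : R, 0 < r &
    forall t : Cplx R, `|t| < toC r ->
      [/\ cvgn (even_series q (fun n => toC (alpha n)) t), gq q alpha t != 0
        & even_series q (fun n => toC (beta n)) t @ \oo --> (gq q alpha t)^-1].
Proof.
move=> ab [t0 t00 ct0].
have [M aM] := even_series_coef_bound alpha t0 t00 ct0.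
set r := (cnorm t0 ^+ 2)^-1 in aM.
have r0 : 0 <= r by rewrite invr_ge0 exprn_ge0 ?cnorm_ge0.
pose a n := alpha n / qfact q (2 * n).+1.
pose b n := beta n / qfact q (2 * n).+1.
have ab1 : fps_mul a b =1 @fps_one R.
  move=> n; rewrite fps_mulC /fps_one -ab; apply: eq_bigr => i _.
  by rewrite /a /b; field; rewrite !qfact_neq0.
have M0 : 0 <= M by have := aM 0%N; rewrite expr0 mulr1; apply: le_trans.
have bM := reciprocal_coef_bound a b M r r0 aM ab1.
set K := r * _ in bM.
(* As r <= K, a radius that works for the beta-series works for the alpha-series too. *)
have rK : r <= K by rewrite ler_peMr// lerDl mulr_ge0.
have K0 : 0 <= K by exact: le_trans rK.
(* From |t| (1 + K) < 1 follow |t| <= 1 and K |t| < 1, hence K |t|^2 < 1. *)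
exists (1 + K)^-1 => [|t]; first by rewrite invr_gt0 ltr_wpDr.
rewrite normCE toC_lt => tr.
have tK : cnorm t * (1 + K) < 1 by rewrite -ltr_pdivlMr ?ltr_wpDr// mul1r.
have Kt : K * cnorm t ^+ 2 < 1.
  have := cnorm_ge0 t; move: (cnorm t) tK => x tK x0.
  have xK : 0 <= x * K by rewrite mulr_ge0.
  have x1 : x <= 1 by lra.
  by have := ler_wpM2l xK x1; rewrite expr2; lra.
have rt : r * cnorm t ^+ 2 < 1.
  by rewrite (le_lt_trans _ Kt)// ler_wpM2r ?exprn_ge0 ?cnorm_ge0.
have calpha := even_series_geometric_cvg _ _ _ _ r0 rt aM.
have cbeta := even_series_geometric_cvg _ _ _ _ K0 Kt bM.
have [g0 gbeta] := gq_reciprocal _ _ _ ab calpha cbeta.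
exact: And3 calpha g0 gbeta.
Qed.

End Analytic.

Theorem theorem2p26 (R : realType) (q : R) (hq0 : 0 < q) (hq1 : q < 1)
    (alpha beta : nat -> R) (p phat : nat -> {poly R})
    (hconj : conjugate_qLidstone_I q alpha beta p phat) :
  (* as formal power series in t over the polynomials in z; the second
     equation says that the beta-series is 1 / g_q(t) *)
  [/\ fps_mul (fps_even q (fun n => (alpha n)%:P)) (fps_sinhq_div q)
        =1 fps_even q p,
      fps_mul (fps_even q (fun n => (alpha n)%:P)) (fps_even q (fun n => (beta n)%:P))
        =1 @fps_one {poly R}
    & fps_mul (fps_even q (fun n => (beta n)%:P)) (fps_sinhq_div q)
        =1 fps_even q phat]
  /\
  (* as functions of complex z and t, wherever sinh_q(z t), g_q(t) and, for
     the second identity, the series of 1 / g_q(t) converge *)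
  [/\ forall z t : Cplx R,
        t != 0 -> `|z * t| < toC ((1 - q)^-1) ->
        cvgn (even_series q (fun n => toC (alpha n)) t) ->
        even_series q (fun n => cpoly (p n) z) t @ \oo -->
          gq q alpha t * (sinhq q (z * t) / t),
      forall z t : Cplx R,
        t != 0 -> `|z * t| < toC ((1 - q)^-1) ->
        cvgn (even_series q (fun n => toC (alpha n)) t) ->
        cvgn (even_series q (fun n => toC (beta n)) t) ->
        gq q alpha t != 0 /\
        even_series q (fun n => cpoly (phat n) z) t @ \oo -->
          (gq q alpha t)^-1 * (sinhq q (z * t) / t)
    & (* if g_q has positive radius of convergence, so has 1/g_q *)
      (exists2 t0 : Cplx R,
         t0 != 0 & cvgn (even_series q (fun n => toC (alpha n)) t0)) ->
      exists2 r : R, 0 < r &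
        forall t : Cplx R, `|t| < toC r ->
          [/\ cvgn (even_series q (fun n => toC (alpha n)) t), gq q alpha t != 0
            & even_series q (fun n => toC (beta n)) t @ \oo --> (gq q alpha t)^-1]].
Proof.
have [pL rel ab phatE] := hconj.
(* For p the normalised formula comes from the recursion, for phat from its explicit definition;
   from here on both are treated alike. *)
have pE n := qLidstone_term q hq0 hq1 p alpha n pL rel.
have hE n := etrans (congr1 (GRing.scale _) (phatE n))
  (qLidstone_poly_term q hq0 hq1 beta n).
split; split.
- exact: fps_even_mul_sinhq.
- exact: fps_even_mul_conj.
- exact: fps_even_mul_sinhq.
- move=> z t t0 zt calpha.
  exact: (even_series_mul q hq0 hq1 alpha p z t _ t0 zt pE calpha).
- move=> z t t0 zt calpha cbeta.
  have [g0 gbeta] := gq_reciprocal q hq0 hq1 _ _ _ ab calpha cbeta.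
  exact: conj g0 (even_series_mul q hq0 hq1 beta phat z t _ t0 zt hE gbeta).
- exact: gq_reciprocal_radius.
Qed.
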